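(* For every non-negative integer $n$, $T(n) \neq 2$.
   Context: A square-product sequence is a strictly increasing finite sequence of integers $a_1 < a_2 < \cdots < a_t$ ($t \geq 1$) whose product $a_1 a_2 \cdots a_t$ is a perfect square (the square of an integer). For a non-negative integer $n$, $g(n)$ is the least integer $k$ such that there exists a square-product sequence $n = a_1 < a_2 < \cdots < a_t = k$. A corresponding sequence for $g(n)$ is a square-product sequence whose first term is $n$ and whose last term is $g(n)$. $T(n)$ is the least $t$ such that there exists a corresponding sequence $n = a_1 < \cdots < a_t = g(n)$ of length $t$. *)

(* Defs.v *)
From mathcomp Require Import all_boot all_order all_algebra.
From mathcomp Require Import boolp.

Set Implicit Arguments.
Unset Strict Implicit.
Unset Printing Implicit Defensive.

Import Order.TTheory GRing.Theory Num.Theory.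
Local Open Scope ring_scope.

Definition square_product (s : seq int) : Prop :=
  [/\ s <> [::], sorted <%R s & exists b : int, \prod_(a <- s) a = b ^+ 2].

(* The defaults of [head] and [last] are irrelevant, since [s] is nonempty. *)
Definition square_product_from_to (n k : int) (s : seq int) : Prop :=
  [/\ square_product s, head 0 s = n & last 0 s = k].

Lemma square_product_from_ex (n : nat) :
  exists k : nat, `[< exists s, square_product_from_to n k s >].
Proof.
exists (4 * n)%N; apply/asboolP.
case: (posnP n) => [->|n0].
  exists [:: 0]; split=> //; split=> //.
  by exists 0; rewrite big_seq1 expr0n.
exists [:: n%:Z; (4 * n)%:Z]; split=> //; split=> //.
  by rewrite /= ltz_nat ltn_Pmull.
exists (2 * n%:Z); rewrite !big_cons big_nil mulr1 PoszM exprMn mulrCA.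
by rewrite -expr2.
Qed.

(* Minimizing over natural [k] loses nothing: the last term of a strictly
   increasing sequence is at least its first term [n] (see [g_min]). *)
Definition g (n : nat) : nat := ex_minn (square_product_from_ex n).

Lemma g_ex (n : nat) : exists s, square_product_from_to n (g n) s.
Proof. by rewrite /g; case: ex_minnP => k /asboolP. Qed.

Lemma g_min (n : nat) (k : int) (s : seq int) :
  square_product_from_to n k s -> (g n)%:Z <= k.
Proof.
move=> sk; have nk : n%:Z <= k.
  case: sk => -[s0 + _]; case: s s0 => // a s _ /= + <- <-.
  rewrite lt_path_sortedE => /andP[/allP sa _].
  by have := mem_last a s; rewrite inE => /predU1P[->//|/sa/ltW].
case: k => // k in sk nk *.
by rewrite lez_nat /g; case: ex_minnP => m _; apply; apply/asboolP; exists s.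
Qed.

Definition corresponding_sequence (n : nat) (s : seq int) : Prop :=
  square_product_from_to n (g n) s.

Lemma corresponding_sequence_ex (n : nat) :
  exists t : nat, `[< exists2 s, corresponding_sequence n s & size s = t >].
Proof. by have [s sP] := g_ex n; exists (size s); apply/asboolP; exists s. Qed.

Definition T (n : nat) : nat := ex_minn (corresponding_sequence_ex n).

(* Main.v *)
(** If [T n = 2] then [n < k = g n] and [n * k] is a square, so [n = d * a ^ 2] and
    [k = d * c ^ 2] with [a < c]. If [n] is a square then [g n = n]; otherwise [d > 1] and
    the 2x2 grid of products of [d * a], [d * a + 1] with [a], [a + 1] is a
    square-product sequence from [n] whose last term is less than
    [d * (a + 1) ^ 2 <= k]. *)
Require Import Defs.
From mathcomp Require Import all_boot all_order all_algebra.
From mathcomp Require Import boolp ring zify.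

Set Implicit Arguments.
Unset Strict Implicit.
Unset Printing Implicit Defensive.

Import Order.TTheory GRing.Theory Num.Theory.

(** Cancelling [m = gcdn n b] from [n = a * m] and [b = c * m] leaves [a * k = c ^ 2 * m] with [a],
    [c] coprime. Hence [a] divides [m], and [d] is the quotient. *)
Lemma mul_eq_square (n k b : nat) : 0 < n -> n * k = b ^ 2 ->
  exists d a c, n = d * a ^ 2 /\ k = d * c ^ 2.
Proof.
move=> n_gt0 nkb; set m := gcdn n b.
have m_gt0 : 0 < m by rewrite gcdn_gt0 n_gt0.
have [/dvdnP[a na] /dvdnP[c bc]] := (dvdn_gcdl n b, dvdn_gcdr n b).
rewrite -/m in na bc.
have co_ac : coprime a c.
  by rewrite /coprime -(eqn_pmul2r m_gt0) muln_gcdl -na -bc mul1n.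
have a_gt0 : 0 < a by move: n_gt0; rewrite na muln_gt0 => /andP[].
have akc : a * k = c ^ 2 * m.
  apply/eqP; rewrite -(eqn_pmul2r m_gt0); apply/eqP.
  by rewrite mulnAC -na nkb bc; ring.
have /dvdnP[d md] : a %| m.
  by rewrite -(Gauss_dvdr _ (coprimeXr 2 co_ac)) -akc dvdn_mulr.
exists d, a, c; split; first by rewrite na md; ring.
apply/eqP; rewrite -(eqn_pmul2l a_gt0) akc md; apply/eqP; ring.
Qed.

Lemma g_square_le (a : nat) : g (a ^ 2) <= a ^ 2.
Proof.
rewrite -lez_nat; apply: (@g_min _ _ [:: Posz (a ^ 2)]); split=> //; split=> //.
by exists (Posz a); rewrite big_seq1 expr2 -PoszM mulnn.
Qed.

Lemma g_nonsquare_lt (d a : nat) : 1 < d -> 0 < a ->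
  g (d * a ^ 2) < d * a.+1 ^ 2.
Proof.
move=> d_gt1 a_gt0.
suff le_g : g (d * a ^ 2) <= (d * a).+1 * a.+1.
  (* After cancelling [a.+1], this is [d * a + 1 < d * a + d]. *)
  by apply: leq_ltn_trans le_g _; nia.
rewrite -lez_nat.
apply: (@g_min _ _ [:: Posz (d * a ^ 2); Posz ((d * a).+1 * a);
  Posz (d * a * a.+1); Posz ((d * a).+1 * a.+1)]); split=> //; split=> //.
  (* The two middle terms are in order because [a < d * a], again by [1 < d]. *)
  by rewrite /= !ltz_nat; apply/and4P; split=> //; nia.
(* Each of the four factors of the grid occurs in exactly two of its entries. *)
exists (Posz (d * a * (d * a).+1 * a * a.+1)).
by rewrite !big_cons big_nil mulr1 expr2 -!PoszM; congr Posz; ring.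
Qed.

Theorem theorem3p7 (n : nat) : T n <> 2.
Proof.
rewrite /T; case: ex_minnP => _ /asboolP[s [[_ s_inc [b prod_s]]]] hd_s last_s <-.
case: s => [|x [|y []]] //= in s_inc prod_s hd_s last_s * => _.
move: s_inc prod_s; rewrite hd_s last_s andbT ltz_nat => n_lt_g.
(* The root [b] may be negative, so absolute values are taken to pass to [nat]. *)
rewrite !big_cons big_nil mulr1 => /(congr1 absz).
rewrite abszM abszX /= => ng.
have [n0|n_gt0] := posnP n; first by move: n_lt_g; rewrite n0 ltnNge (g_square_le 0).
have [d [a [c [nE gE]]]] := mul_eq_square n_gt0 ng.
have a_gt0 : 0 < a by case: a nE => //; lia.
have a_lt_c : a < c.
  rewrite ltnNge; apply/negP => le_ca.
  by move: n_lt_g; rewrite gE {1}nE ltnNge leq_mul2l leq_sqr le_ca orbT.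
have [d_gt1|d_le1] := ltnP 1 d.
  have := g_nonsquare_lt d_gt1 a_gt0; rewrite -nE gE ltnNge => /negP[].
  by rewrite leq_mul2l leq_sqr a_lt_c orbT.
have d_gt0 : 0 < d by move: n_gt0; rewrite nE muln_gt0 => /andP[].
have d1 : d = 1 by apply/eqP; rewrite eqn_leq d_le1.
by have := g_square_le a; rewrite d1 mul1n in nE; rewrite -nE leqNgt n_lt_g.
Qed.
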